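(* Let $a\in\mathbb{R}$, let $f:\mathbb{N}_a\to\mathbb{R}$, and let $0<\mu<1$ and $0\le\nu\le 1$. Then for all $x\in\mathbb{N}_{a+1}$: (i) $\Delta_{a+1-\mu}^{-\mu}\big[\Delta_a^{\mu,\nu}f\big](x)=\Delta_{a+(1-\nu)(1-\mu)}^{-(\mu+\nu-\mu\nu)}\,\Delta\,\Delta_a^{-(1-\nu)(1-\mu)}f(x)$; (ii) $\Delta_{a+1-\mu}^{-\mu}\big[\Delta_a^{\mu,\nu}f\big](x)=\Delta_{a+(1-\nu)(1-\mu)}^{-(\mu+\nu-\mu\nu)}\,\Delta_a^{\mu+\nu-\mu\nu}f(x)$; (iii) $\Delta_{a+\mu}^{\mu,\nu}\big[\Delta_a^{-\mu}f\big](x)=\Delta_{a+(1-\nu+\mu\nu)}^{-\nu(1-\mu)}\,\Delta_a^{\nu(1-\mu)}f(x)$; (iv) $\Delta_{a+\mu}^{\mu,\nu}\big[\Delta_a^{-\mu}f\big](x)=f(x)-\Big(\Delta_a^{-(1-\nu(1-\mu))}f\Big)\big(a+1-\nu(1-\mu)\big)\cdot h_{\nu(1-\mu)-1}\big(x,\,a+1-\nu(1-\mu)\big)$.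
   Context: For $b\in\mathbb{R}$, $\mathbb{N}_b=\{b,b+1,b+2,\dots\}$; $\sigma(t)=t+1$; $\Delta f(x)=f(x+1)-f(x)$. Generalized falling function: $t^{\underline{\alpha}}=\Gamma(t+1)/\Gamma(t+1-\alpha)$, with value $0$ when $t+1-\alpha$ is a pole of $\Gamma$ and $t+1$ is not. Fractional Taylor monomial: $h_{\alpha}(t,s)=\frac{(t-s)^{\underline{\alpha}}}{\Gamma(\alpha+1)}$, with the convention $1/\Gamma(0)=0$. Delta fractional sum: for $\alpha>0$ and $f:\mathbb{N}_b\to\mathbb{R}$, $\Delta_b^{-\alpha}f(x)=\sum_{\tau=b}^{x-\alpha}h_{\alpha-1}(x,\sigma(\tau))f(\tau)$ for $x\in\mathbb{N}_{b+\alpha}$ (sum over $\tau\in\{b,b+1,\dots,x-\alpha\}$). A sum or difference of order $0$ is the identity. Riemann-Liouville fractional difference: for $0<\alpha\le 1$ and $f:\mathbb{N}_b\to\mathbb{R}$, $\Delta_b^{\alpha}f(x)=\Delta\,\Delta_b^{-(1-\alpha)}f(x)$, $x\in\mathbb{N}_{b+1-\alpha}$. Hilfer fractional difference of order $0<\mu<1$ and type $0\le\nu\le1$ of $f:\mathbb{N}_b\to\mathbb{R}$: $\Delta_b^{\mu,\nu}f(x)=\Delta_{b+(1-\nu)(1-\mu)}^{-\nu(1-\mu)}\,\Delta\,\Delta_b^{-(1-\nu)(1-\mu)}f(x)$ for $x\in\mathbb{N}_{b+1-\mu}$. *)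

(* Defs.v *)
From HB Require Import structures.
From mathcomp Require Import all_boot all_order all_algebra.
From mathcomp Require Import all_classical all_reals all_analysis.

Set Implicit Arguments.
Unset Strict Implicit.
Unset Printing Implicit Defensive.

Import Order.TTheory GRing.Theory Num.Theory.
Import numFieldNormedType.Exports.
Local Open Scope classical_set_scope.
Local Open Scope ring_scope.

(* Euler's integral of the second kind, meaningful for 0 < x. *)
Definition euler_gamma (R : realType) (x : R) : R :=
  \int[lebesgue_measure]_(t in `]0, +oo[) (t `^ (x - 1) * expR (- t)).

(* The real Gamma function. For x <= 0 it is extended by the functional
   equation Gamma (x + n) = x (x + 1) ... (x + n - 1) Gamma x, with n the least
   natural number such that 0 < x + n. At the poles 0, -1, -2, ... the product
   vanishes, so that Gamma, and hence also (Gamma x)^-1, takes the value 0 there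
   (since 0^-1 = 0). *)
Definition Gamma (R : realType) (x : R) : R :=
  if 0 < x then euler_gamma x
  else let n := (Num.truncn (- x)).+1 in
       euler_gamma (x + n%:R) / \prod_(k < n) (x + k%:R).

Definition Gamma_pole (R : realType) : set R := [set - n%:R | n in [set: nat]].

Lemma Gamma_at_pole (R : realType) (x : R) : Gamma_pole x -> Gamma x = 0.
Proof.
move=> [n _ <-]; rewrite /Gamma oppr_gt0 ltrn0 opprK natrK.
by rewrite (bigD1 ord_max) //= addNr mul0r invr0 mulr0.
Qed.

(* t^{\underline{alpha}}; it is 0 when t + 1 - alpha is a pole of Gamma, by
   Gamma_at_pole. *)
Definition falling (R : realType) (t alpha : R) : R :=
  Gamma (t + 1) / Gamma (t + 1 - alpha).

Lemma falling_at_pole (R : realType) (t alpha : R) :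
  Gamma_pole (t + 1 - alpha) -> falling t alpha = 0.
Proof. by move=> p; rewrite /falling (Gamma_at_pole p) invr0 mulr0. Qed.

(* For alpha = -1 this is 0: the convention 1 / Gamma 0 = 0. *)
Definition taylor_mono (R : realType) (alpha t s : R) : R :=
  falling (t - s) alpha / Gamma (alpha + 1).

Lemma taylor_monoN1 (R : realType) (t s : R) : taylor_mono (- 1) t s = 0.
Proof.
rewrite /taylor_mono addNr (@Gamma_at_pole _ 0) ?invr0 ?mulr0//.
by exists 0%N => //; rewrite oppr0.
Qed.

(* N_b = {b, b + 1, b + 2, ...} *)
Definition nats_from (R : realType) (b : R) : set R :=
  [set b + n%:R | n in [set: nat]].

(* A function on N_b is represented by a total function R -> R; the operators
   below, evaluated at points of their domain, only use its values on N_b. *)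

Definition sigma (R : realType) (t : R) : R := t + 1.

Definition fdiff (R : realType) (f : R -> R) : R -> R :=
  fun x => f (x + 1) - f x.

(* Delta_b^{-alpha}, for 0 <= alpha *)
Definition frac_sum (R : realType) (b alpha : R) (f : R -> R) : R -> R :=
  if alpha == 0 then f else fun x =>
    \sum_(tau \in [set tau | nats_from b tau /\ tau <= x - alpha])
      taylor_mono (alpha - 1) x (sigma tau) * f tau.

(* Riemann-Liouville Delta_b^{alpha}, for 0 <= alpha <= 1 *)
Definition frac_diff (R : realType) (b alpha : R) (f : R -> R) : R -> R :=
  if alpha == 0 then f else fdiff (frac_sum b (1 - alpha) f).

(* Hilfer Delta_b^{mu, nu} *)
Definition hilfer_diff (R : realType) (b mu nu : R) (f : R -> R) : R -> R :=
  frac_sum (b + (1 - nu) * (1 - mu)) (nu * (1 - mu))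
    (fdiff (frac_sum b ((1 - nu) * (1 - mu)) f)).

(* Main.v *)
Require Import Defs.
From mathcomp Require Import all_boot all_order all_algebra.
From mathcomp Require Import all_classical all_reals all_analysis.
From mathcomp Require Import measurable_realfun ring lra.
Local Open Scope ring_scope.
Set Implicit Arguments.
Unset Strict Implicit.
Unset Printing Implicit Defensive.
Import Order.TTheory GRing.Theory Num.Theory.
Import numFieldNormedType.Exports.

(** On the orbit b, b + 1, b + 2, ... every operator of the statement is a
    discrete convolution.  The weight h_{al-1}(x, sigma tau) with
    x - sigma tau = al - 1 + m is Gamma (al + m) / (m! Gamma al), that is the
    coefficient al (al + 1) ... (al + m - 1) / m! of z^m in (1 - z)^(-al)
    ([taylor_mono_rising]).  Hence the fractional sum of order al, read as a
    sequence, is the Cauchy product with (1 - z)^(-al) ([frac_sumE]; for al = 0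
    the series is 1, so the identity convention fits).

    Consequently (1 - z)^(-al) (1 - z)^(-be) = (1 - z)^(-(al + be)) gives the
    semigroup law ([frac_sum_frac_sum]).  The first identity is this law applied
    to the two outer sums, and the second only rewrites the inner difference as
    a Riemann-Liouville one.  In the last two the law merges the two inner sums
    into one sum H of order 1 - ga, where ga = nu (1 - mu), so that a sum of
    order ga of the forward difference of H remains; this is the third identity.
    The series of that difference is ((1 - z) H(z) - H 0) / z.  Multiplying it by
    (1 - z)^(-ga), with H(z) = (1 - z)^(-(1 - ga)) F(z), leaves
    (F(z) - H 0 (1 - z)^(-ga)) / z: the values of f one step later, minus the
    boundary term ([frac_sum_fdiff_frac_sum]).

    The analytic input is what identifies the weights: the functional equation
    of Gamma on the positive axis, its values n! at n + 1, and Gamma > 0. *)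

(** * Euler's integral on the positive axis *)

Section GammaIntegral.
Local Open Scope classical_set_scope.
Variable R : realType.
Implicit Types (x t : R) (n : nat).
Local Notation mu := (@lebesgue_measure R).

Definition gamma_integrand x t : R := t `^ (x - 1) * expR (- t).

Lemma gamma_integrand_ge0 x t : 0 <= gamma_integrand x t.
Proof. by rewrite mulr_ge0 ?powR_ge0 ?expR_ge0. Qed.

Lemma continuous_powR_pos x t : 0 < t -> {for t, continuous (@powR R ^~ x)}.
Proof.
move=> t0; apply: differentiable_continuous; apply/derivable1_diffP.
by apply: derivable_powR; rewrite in_itv/= t0.
Qed.

Lemma continuous_expRN t : {for t, continuous (fun u : R => expR (- u))}.
Proof.
apply: continuous_comp; last exact: continuous_expR.
exact: (@continuousN _ R^o).
Qed.

Lemma continuous_gamma_integrand x t : 0 < t ->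
  {for t, continuous (gamma_integrand x)}.
Proof.
move=> t0; apply: (@continuousM _ R^o).
  exact: continuous_powR_pos.
exact: continuous_expRN.
Qed.

Lemma measurable_gamma_integrand x (A : set R) : measurable A ->
  A `<=` `]0, +oo[ -> measurable_fun A (EFin \o gamma_integrand x).
Proof.
move=> mA A0; apply/measurable_EFinP.
apply: (@measurable_funS _ _ _ _ (`]0, +oo[%classic : set R)) => //.
apply: open_continuous_measurable_fun => //.
by move=> t; rewrite inE/= in_itv/= andbT; exact: continuous_gamma_integrand.
Qed.

(** Euler's integral is improper at both ends when x < 1; compact windows
    exhausting the half-line make integration by parts applicable. *)
Definition gamma_window n : set R := `[n.+2%:R^-1, n.+2%:R]%classic.

Lemma gamma_window_gt0 n t : gamma_window n t -> 0 < t.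
Proof.
by rewrite /gamma_window/= in_itv/= => /andP[+ _]; apply: lt_le_trans.
Qed.

Lemma bigcup_gamma_window : \bigcup_n gamma_window n = `]0, +oo[%classic.
Proof.
apply/seteqP; split=> [t [n _ /gamma_window_gt0 t0]|t].
  by rewrite /= in_itv/= t0.
rewrite /= in_itv/= andbT => t0.
exists (Num.truncn (t + t^-1)) => //.
have ht : t + t^-1 < (Num.truncn (t + t^-1)).+1%:R.
  by rewrite truncnS_gt ?addr_ge0 ?invr_ge0 ?ltW.
have tV0 : 0 < t^-1 by rewrite invr_gt0.
set N := Num.truncn _ in ht *.
have N2 : (N.+1%:R : R) <= N.+2%:R by rewrite ler_nat.
rewrite /gamma_window/= in_itv/=; apply/andP; split; last by lra.
by rewrite invf_ple ?posrE//; lra.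
Qed.

Lemma nondecreasing_gamma_window : nondecreasing_seq gamma_window.
Proof.
move=> m n mn; apply/subsetPset => t; rewrite /gamma_window/= !in_itv/=.
move=> /andP[tm tM]; apply/andP; split.
  by apply: le_trans tm; rewrite lef_pV2 ?posrE// ler_nat !ltnS.
by apply: le_trans tM _; rewrite ler_nat !ltnS.
Qed.

(** Kept in the extended reals: as the integrand is nonnegative, the functional
    equation can then be proved before finiteness, which it helps to prove. *)
Definition gamma_integral x : \bar R :=
  (\int[mu]_(t in `]0%R, +oo[) (gamma_integrand x t)%:E)%E.

Lemma cvg_gamma_window x :
  ((\int[mu]_(t in gamma_window n) (gamma_integrand x t)%:E)%E @[n --> \oo]
     --> gamma_integral x).
Proof.
rewrite /gamma_integral -bigcup_gamma_window.
apply: ge0_nondecreasing_set_cvg_integral.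
- exact: nondecreasing_gamma_window.
- by move=> n; exact: measurable_itv.
- move=> n; apply: measurable_gamma_integrand; first exact: measurable_itv.
  by move=> t /gamma_window_gt0 t0; rewrite /= in_itv/= t0.
- by move=> n t _; rewrite lee_fin gamma_integrand_ge0.
Qed.

Lemma gamma_integral_ge0 x : (0 <= gamma_integral x)%E.
Proof. by apply: integral_ge0 => t _; rewrite lee_fin gamma_integrand_ge0. Qed.

(** With k an integer above x, the Taylor bound expR t >= t^(k+1) / (k+1)! shows
    that the function is at most (k+1)! / t for t >= 1. *)
Lemma powR_expRN_cvgy x : t `^ x * expR (- t) @[t --> +oo] --> (0:R).
Proof.
set k := (Num.truncn `|x|).+1.
have xk : x <= k%:R.
  by rewrite (le_trans (ler_norm _))// ltW// truncnS_gt.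
apply: (@squeeze_cvgr _ _ _ _ (cst 0) (fun t : R => k.+1`!%:R * t^-1)).
- near=> t.
  have t1 : 1 <= t by near: t; apply: nbhs_pinfty_ge; exact: num_real.
  have t0 : 0 < t by lra.
  rewrite mulr_ge0 ?powR_ge0 ?expR_ge0//=.
  rewrite expRN -ler_pdivlMr ?invr_gt0 ?expR_gt0// invrK.
  apply: (@le_trans _ _ (t ^+ k)).
    by rewrite -powR_mulrn ?(ltW t0)// ler_powR.
  have := expR_ge1Dxn k (ltW t0).
  set E := expR t => hE.
  have kf : 0 < k.+1`!%:R :> R by rewrite ltr0n fact_gt0.
  have : t ^+ k.+1 / k.+1`!%:R <= E by lra.
  by rewrite ler_pdivrMr// exprS mulrAC ler_pdivlMr// mulrC [E * _]mulrC.
- exact: cvg_cst.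
- rewrite -(mulr0 (k.+1`!%:R : R)); apply: cvgMr.
  by apply/gtr0_cvgV0; [near=> t|exact: cvg_id].
Unshelve. all: by end_near. Qed.

Lemma cvgr_natSS : (n.+2%:R : R) @[n --> \oo] --> +oo.
Proof.
have := @cvgr_idn R; rewrite -(cvg_shiftn 2)/=.
by under eq_fun do rewrite addn2.
Qed.

(** Integration by parts on each window; the boundary term B vanishes in the limit
    at the lower end because 0 < x, at the upper end by exponential decay. *)
Lemma gamma_integralD1 x : 0 < x ->
  gamma_integral (x + 1) = (x%:E * gamma_integral x)%E.
Proof.
move=> x0.
pose B n : R := (n.+2%:R : R)^-1 `^ x * expR (- (n.+2%:R)^-1)
                - n.+2%:R `^ x * expR (- n.+2%:R).
have B0 : B n @[n --> \oo] --> (0 : R).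
  rewrite -[0 in X in _ --> X](subr0 0); apply: cvgB.
    have : t `^ x * expR (- t) @[t --> 0^'+] --> (0 * expR (- 0) : R).
      apply: cvgM; first exact: powR_cvg0.
      by apply: cvg_at_right_filter; exact: continuous_expRN.
    rewrite mul0r => /cvg_at_rightP; apply; split; first by move=> n; rewrite invr_gt0.
    by apply/gtr0_cvgV0; [near=> n|exact: cvgr_natSS].
  have /cvg_pinftyP := powR_expRN_cvgy x; apply; exact: cvgr_natSS.
have parts n : (\int[mu]_(t in gamma_window n) (gamma_integrand (x + 1) t)%:E
   = (B n)%:E + x%:E * \int[mu]_(t in gamma_window n) (gamma_integrand x t)%:E)%E.
  have ab : (n.+2%:R)^-1 < (n.+2%:R : R).
    by rewrite (@lt_trans _ _ 1) ?invf_lt1 ?ltr1n.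
  have cwin (h : R -> R) : (forall t, 0 < t -> {for t, continuous h}) ->
      {within gamma_window n, continuous h}.
    move=> ch; apply: continuous_in_subspaceT => t.
    by rewrite inE => /gamma_window_gt0; exact: ch.
  have cpow : forall t, 0 < t -> {for t, continuous (fun t : R => x * t `^ (x - 1))}.
    move=> t t0; apply: (@continuousM _ R^o); first exact: cst_continuous.
    exact: continuous_powR_pos.
  rewrite (@eq_integral _ _ _ mu _ (fun t => (t `^ x * expR (- t))%:E)); last first.
    by move=> t _; rewrite /gamma_integrand addrK.
  rewrite (@integration_by_parts R (@powR R ^~ x) (fun t => - expR (- t))
    (fun t => x * t `^ (x - 1)) (fun t => expR (- t)) _ _ ab).
  - rewrite /B.
    rewrite (@eq_integral _ _ _ mu _ (fun t => ((- x)%:E * (gamma_integrand x t)%:E)%E)).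
      rewrite integralZl//; last first.
        apply: continuous_compact_integrable; first exact: segment_compact.
        by apply: cwin => t t0; exact: continuous_gamma_integrand.
      rewrite EFinN mulNe oppeK; congr (_%:E + _)%E; ring.
    by move=> t _; rewrite -EFinM /gamma_integrand; congr _%:E; ring.
  - exact: cwin.
  - split=> [t||].
    + rewrite in_itv/= => /andP[at_ _]; apply: ex_derive; apply: is_derive1_powR.
      by apply: lt_trans at_.
    + by apply: cvg_at_right_filter; apply: continuous_powR_pos.
    + by apply: cvg_at_left_filter; apply: continuous_powR_pos.
  - move=> t; rewrite in_itv/= => /andP[at_ _]; apply: powR_derive1.
    by rewrite in_itv/= andbT; apply: lt_trans at_.
  - by apply: cwin => t _; exact: continuous_expRN.
  - split=> [t _||].
    + exact: ex_derive.
    + by apply: cvg_at_right_filter; apply: cvgN; apply: continuous_expRN.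
    + by apply: cvg_at_left_filter; apply: cvgN; apply: continuous_expRN.
  - move=> t _; rewrite derive1E derive_val; rewrite /GRing.scale/=; ring.
have := @cvg_gamma_window (x + 1).
under eq_cvg do rewrite parts.
move/cvg_lim => <- //.
apply/cvg_lim => //.
rewrite -[X in _ --> X]add0e.
apply: cvgeD => //.
- by apply: cvg_EFin; [exact: nearW|exact: B0].
- apply: cvgeZl => //; exact: cvg_gamma_window.
Unshelve. all: by end_near. Qed.

Lemma gamma_integral1 : gamma_integral 1 = 1%E.
Proof.
rewrite -(@integral_exponential_pdf R 1 ltr01) /gamma_integral.
rewrite integral_itv_obnd_cbnd; last first.
  exact: measurable_gamma_integrand.
rewrite [RHS](_ : _ = (\int[mu]_t ((EFin \o gamma_integrand 1) \_ `[0%R, +oo[%classic) t)%E).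
  by rewrite integral_mkcond.
apply: eq_integral => t _; rewrite /exponential_pdf !patchE/=.
by case: ifP => // _; rewrite /gamma_integrand subrr powRr0 mulN1r.
Qed.

Lemma gamma_integral_natS n : gamma_integral n.+1%:R = (n`!%:R)%:E.
Proof.
elim: n => [|n IH]; first by rewrite gamma_integral1 fact0.
by rewrite -natr1 gamma_integralD1 ?ltr0n// IH -EFinM -natrM factS.
Qed.

(** By the functional equation it is enough to bound the integral at x + 1, where
    the singularity at 0 is gone: t^x is below 1 for t <= 1 and below an integer
    power of t beyond, so two factorial values dominate. *)
Lemma gamma_integral_fin x : 0 < x -> gamma_integral x \is a fin_num.
Proof.
move=> x0.
have : (x%:E * gamma_integral x < +oo)%E.
  set k := Num.truncn x.
  rewrite -gamma_integralD1//.
  apply: (@le_lt_trans _ _ (gamma_integral 1 + gamma_integral k.+2%:R)%E); last first.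
    by rewrite gamma_integral1 gamma_integral_natS -EFinD ltry.
  rewrite /gamma_integral -ge0_integralD//; last 4 first.
  - by move=> t _; rewrite lee_fin gamma_integrand_ge0.
  - exact: measurable_gamma_integrand.
  - by move=> t _; rewrite lee_fin gamma_integrand_ge0.
  - exact: measurable_gamma_integrand.
  apply: ge0_le_integral => //.
  - by move=> t _; rewrite lee_fin gamma_integrand_ge0.
  - exact: measurable_gamma_integrand.
  - by apply: emeasurable_funD; exact: measurable_gamma_integrand.
  - move=> t; rewrite /= in_itv/= andbT => t0.
    rewrite -EFinD lee_fin /gamma_integrand -mulrDl ler_wpM2r ?expR_ge0//.
    rewrite addrK subrr powRr0 -natr1 addrK.
    have [t1|t1] := leP t 1.
      rewrite (@le_trans _ _ 1) ?lerDl ?powR_ge0//.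
      rewrite -(powRr0 t); apply: ger_powR; first by rewrite t0.
      exact: ltW.
    rewrite (@le_trans _ _ (t `^ k.+1%:R)) ?lerDr//.
    by apply: ler_powR; rewrite ltW// truncnS_gt.
rewrite ge0_fin_numE ?gamma_integral_ge0//.
have := gamma_integral_ge0 x; case: (gamma_integral x) => [r| |] //=.
  by move=> *; exact: ltry.
by rewrite gt0_muley ?lte_fin.
Qed.

(** Already on [1, 2] the integrand is bounded below by a positive constant; which
    end of [1, 2] minimises t^(x - 1) depends on the sign of x - 1. *)
Lemma gamma_integral_gt0 x : 0 < x -> (0 < gamma_integral x)%E.
Proof.
move=> x0; pose c : R := Num.min 1 (2 `^ (x - 1)) * expR (- 2).
have c0 : 0 < c by rewrite mulr_gt0 ?expR_gt0// lt_min ltr01 powR_gt0.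
have itv12 : (`[1, 2]%classic : set R) `<=` `]0, +oo[.
  by move=> t; rewrite /= !in_itv/= andbT => /andP[+ _]; exact: lt_le_trans.
apply: (@lt_le_trans _ _ (\int[mu]_(t in `[1%R, 2%R]) (cst c%:E t))%E).
  rewrite integral_cst//= lebesgue_measure_itv/= lte_fin ltr1n/=.
  by rewrite -EFinD -EFinM lte_fin mulr_gt0// subr_gt0 ltr1n.
apply: (@le_trans _ _ (\int[mu]_(t in `[1%R, 2%R]) (gamma_integrand x t)%:E)%E); last first.
  apply: ge0_subset_integral => //.
    exact: measurable_gamma_integrand.
  by move=> t _; rewrite lee_fin gamma_integrand_ge0.
apply: ge0_le_integral => //.
- by move=> t _; rewrite lee_fin ltW.
- exact: measurable_gamma_integrand.
move=> t; rewrite /= in_itv/= => /andP[t1 t2]; rewrite lee_fin.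
have t0 : 0 < t by exact: lt_le_trans t1.
rewrite /c /gamma_integrand; apply: ler_pM; rewrite ?expR_ge0 ?ler_expR ?lerN2//.
rewrite ge_min; have [x1|x1] := leP 1 x.
  by rewrite -{1}(powRr0 t) ler_powR ?subr_ge0.
apply/orP; right; rewrite -[x - 1]opprB !powRN lef_pV2 ?posrE ?powR_gt0//.
by apply: ge0_ler_powR; rewrite ?nnegrE ?subr_ge0 ?(ltW x1) ?(ltW t0).
Qed.

Lemma GammaE x : 0 < x -> Gamma x = fine (gamma_integral x).
Proof. by rewrite /Gamma => ->. Qed.

Lemma Gamma_gt0 x : 0 < x -> 0 < Gamma x.
Proof.
move=> x0; rewrite GammaE// fine_gt0// gamma_integral_gt0//=.
by rewrite -ge0_fin_numE ?gamma_integral_ge0// gamma_integral_fin.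
Qed.

Lemma GammaD1 x : 0 < x -> Gamma (x + 1) = x * Gamma x.
Proof.
move=> x0; rewrite !GammaE ?addr_gt0// gamma_integralD1// fineM//.
exact: gamma_integral_fin.
Qed.

Lemma Gamma_natS n : Gamma n.+1%:R = n`!%:R :> R.
Proof. by rewrite GammaE// gamma_integral_natS. Qed.

End GammaIntegral.

(** * Cauchy products of sequences *)

Section Convolution.
Variable K : comNzRingType.
Implicit Types F G H : nat -> K.

Definition conv F G : nat -> K := fun n => \sum_(k < n.+1) F k * G (n - k)%N.

(** Associativity and commutativity are inherited from polynomials.  The truncation
    order m is independent of n so that one product of truncated polynomials
    serves for all the inner terms of an iterated convolution. *)
Lemma conv_coefM F G m n : (n <= m)%N ->
  conv F G n = ((\poly_(i < m.+1) F i) * (\poly_(i < m.+1) G i))`_n.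
Proof.
move=> nm; rewrite coefM; apply: eq_bigr => k _.
by rewrite !coef_poly !ltnS (leq_trans (leq_subr _ _) nm)
  (leq_trans (leq_ord k) nm).
Qed.

Lemma convC F G : conv F G = conv G F.
Proof. by apply: funext => n; rewrite !(@conv_coefM _ _ n)// mulrC. Qed.

Lemma convA F G H : conv F (conv G H) = conv (conv F G) H.
Proof.
apply: funext => n.
pose P (E : nat -> K) := \poly_(i < n.+1) E i.
transitivity ((P F * (P G * P H))`_n); last rewrite mulrA.
  rewrite coefM; apply: eq_bigr => k _.
  by rewrite (@conv_coefM _ _ n) ?leq_subr// coef_poly ltn_ord.
rewrite coefM; apply: eq_bigr => k _.
by rewrite (@conv_coefM _ _ n) ?leq_ord// [(P H)`_ _]coef_poly ltnS leq_subr.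
Qed.

Lemma conv_delta F : conv (fun k => (k == 0%N)%:R) F = F.
Proof.
apply: funext => n; rewrite /conv big_ord_recl/= mul1r subn0 big1 ?addr0// => i _.
by rewrite mul0r.
Qed.

(** Summation by parts: the Cauchy product commutes with the shift except for the
    term that carries the initial value of the second sequence. *)
Lemma conv_diff F G n :
  conv F (fun k => G k.+1 - G k) n = conv F G n.+1 - F n.+1 * G 0%N - conv F G n.
Proof.
rewrite {2}/conv big_ord_recr/= subnn addrK -sumrB; apply: eq_bigr => k _.
by rewrite mulrBr subSn// leq_ord.
Qed.

Lemma conv_ones_diff F n : conv (fun=> 1) F n.+1 - conv (fun=> 1) F n = F n.+1.
Proof.
have sumE m : conv (fun=> 1) F m = \sum_(k < m.+1) F k.
  by rewrite convC /conv; apply: eq_bigr => k _; rewrite mulr1.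
by rewrite !sumE big_ord_recr/= addrAC subrr add0r.
Qed.

End Convolution.

(** * The coefficients of (1 - z)^(-al) *)

Section RisingCoefficients.
Variable R : realType.
Implicit Types (al be : R) (n : nat).

Definition rising_coef al n : R := \prod_(j < n) ((al + j%:R) / j.+1%:R).

Lemma rising_coef0r al : rising_coef al 0 = 1.
Proof. by rewrite /rising_coef big_ord0. Qed.

Lemma rising_coefS al n :
  n.+1%:R * rising_coef al n.+1 = (al + n%:R) * rising_coef al n.
Proof.
rewrite /rising_coef big_ord_recr/= mulrC -mulrA divfK ?pnatr_eq0//.
by rewrite mulrC.
Qed.

Lemma rising_coef0 n : rising_coef 0 n = (n == 0%N)%:R.
Proof.
by case: n => [|n]; rewrite /rising_coef ?big_ord0// big_ord_recl/= addr0 !mul0r.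
Qed.

Lemma rising_coef1 n : rising_coef 1 n = 1.
Proof.
by rewrite /rising_coef big1// => i _; rewrite addrC natr1 divff ?pnatr_eq0.
Qed.

(** The Chu-Vandermonde identity.  Both sides equal 1 at n = 0 and satisfy
    (n + 1) u_(n+1) = (al + be + n) u_n: for the left side write n + 1 as
    k + (n + 1 - k) in each term and apply [rising_coefS] to the matching factor. *)
Lemma conv_rising_coef al be :
  conv (rising_coef al) (rising_coef be) = rising_coef (al + be).
Proof.
apply: funext; elim=> [|n IH].
  by rewrite /conv big_ord_recl big_ord0 !rising_coef0r mulr1 addr0.
apply: (@mulfI _ (n.+1%:R : R)); first by rewrite pnatr_eq0.
rewrite rising_coefS -IH /conv !mulr_sumr.
transitivity (\sum_(k < n.+2)
   ((k%:R * rising_coef al k) * rising_coef be (n.+1 - k)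
  + rising_coef al k * ((n.+1 - k)%:R * rising_coef be (n.+1 - k)))).
  apply: eq_bigr => k _.
  have -> : n.+1%:R = k%:R + (n.+1 - k)%:R :> R.
    by rewrite -natrD subnKC ?leq_ord.
  ring.
rewrite big_split/= [X in X + _]big_ord_recl/= [X in _ + X]big_ord_recr/=.
rewrite subnn !mul0r mulr0 add0r addr0 -big_split/=; apply: eq_bigr => k _.
rewrite /bump/= add1n subSS subSn ?leq_ord// !rising_coefS.
have -> : n%:R = k%:R + (n - k)%:R :> R by rewrite -natrD subnKC ?leq_ord.
ring.
Qed.

End RisingCoefficients.

(** * Fractional sums as convolutions *)

Section FracSum.
Local Open Scope classical_set_scope.
Variable R : realType.
Implicit Types (a b x al be : R) (f g : R -> R).

Lemma GammaDn x n : 0 < x -> Gamma (x + n%:R) = Gamma x * \prod_(j < n) (x + j%:R).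
Proof.
move=> x0; elim: n => [|n IH]; first by rewrite big_ord0 mulr1 addr0.
rewrite big_ord_recr/= -natr1 addrA GammaD1 ?ltr_wpDr// IH; ring.
Qed.

Lemma prod_natS n : \prod_(j < n) (j.+1%:R : R) = n`!%:R.
Proof.
elim: n => [|n IH]; first by rewrite big_ord0 fact0.
by rewrite big_ord_recr/= IH factS natrM mulrC.
Qed.

(** The case al = 0 with n > 0 is included because the boundary term of
    [frac_sum_fdiff_frac_sum] needs it: there 1 / Gamma 0 = 0 agrees with the vanishing coefficient.  At al = 0
    and n = 0 the two sides differ, 0 against 1. *)
Lemma taylor_mono_rising al x s n : 0 <= al -> (al == 0) ==> (0 < n)%N ->
  x - s = al - 1 + n%:R -> taylor_mono (al - 1) x s = rising_coef al n.
Proof.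
move=> al0 aln xs; have [al_eq0|al_neq0] := eqVneq al 0.
  rewrite al_eq0 add0r taylor_monoN1 rising_coef0.
  by move: aln; rewrite al_eq0 eqxx/=; case: n {xs}.
have {}al0 : 0 < al by rewrite lt_neqAle eq_sym al_neq0.
rewrite /taylor_mono /falling xs.
have -> : al - 1 + n%:R + 1 = al + n%:R by ring.
have -> : al + n%:R - (al - 1) = n.+1%:R by rewrite -natr1; ring.
rewrite subrK GammaDn// Gamma_natS -prod_natS /rising_coef prodf_div.
have G0 : Gamma al != 0 by rewrite gt_eqF// Gamma_gt0.
have P0 : \prod_(j < n) (j.+1%:R : R) != 0.
  by apply/prodf_neq0 => j _; rewrite pnatr_eq0.
by field; rewrite G0 P0.
Qed.

Lemma frac_sumE b al f n : 0 <= al ->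
  frac_sum b al f (b + al + n%:R)
  = conv (rising_coef al) (fun k => f (b + k%:R)) n.
Proof.
move=> al0; rewrite /frac_sum; case: ifPn => [/eqP ->|al_neq0].
  have -> : rising_coef (0 : R) = fun k => (k == 0%N)%:R.
    by apply: funext => k; exact: rising_coef0.
  by rewrite conv_delta addr0.
have -> : [set tau | nats_from b tau /\ tau <= b + al + n%:R - al]
    = (fun k => b + k%:R) @` `I_n.+1.
  apply/seteqP; split => [_ [[k _ <-] hk]|_ [k /= kn <-]].
    exists k => //=; move: hk.
    have -> : b + al + n%:R - al = b + n%:R by ring.
    by rewrite lerD2l ler_nat.
  split; first by exists k.
  have -> : b + al + n%:R - al = b + n%:R by ring.
  by rewrite lerD2l ler_nat -ltnS.
rewrite fsbig_image; last first.
  by move=> i j _ _ /addrI /eqP; rewrite eqr_nat => /eqP.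
rewrite -fsbig_ord convC /conv; apply: eq_bigr => k _.
rewrite mulrC; congr (_ * _); apply: taylor_mono_rising => //.
  by rewrite (negbTE al_neq0).
by rewrite /sigma natrB ?leq_ord//; ring.
Qed.

Lemma eq_frac_sum b al f g x : 0 <= al -> {in nats_from b, f =1 g} ->
  nats_from (b + al) x -> frac_sum b al f x = frac_sum b al g x.
Proof.
move=> al0 fg [n _ <-]; rewrite !frac_sumE//; congr conv.
by apply: funext => k; apply: fg; rewrite inE; exists k.
Qed.

Lemma frac_sum_frac_sum b al be f x : 0 <= al -> 0 <= be ->
  nats_from (b + al + be) x ->
  frac_sum (b + al) be (frac_sum b al f) x = frac_sum b (al + be) f x.
Proof.
move=> al0 be0 [n _ <-]; rewrite frac_sumE//.
have -> : (fun k => frac_sum b al f (b + al + k%:R))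
    = conv (rising_coef al) (fun k => f (b + k%:R)).
  by apply: funext => k; exact: frac_sumE.
by rewrite convA conv_rising_coef (addrC be) -(addrA b) frac_sumE ?addr_ge0.
Qed.

(** The sum of order ga inverts the Riemann-Liouville difference of order ga only up
    to an initial value.  With H the inner sum as a sequence, [conv_diff] splits
    off H 0, and what remains is the difference of the order-one sum of f. *)
Lemma frac_sum_fdiff_frac_sum b ga f n : 0 <= ga <= 1 ->
  frac_sum (b + (1 - ga)) ga (fdiff (frac_sum b (1 - ga) f)) (b + 1 + n%:R)
  = f (b + 1 + n%:R) - frac_sum b (1 - ga) f (b + (1 - ga))
      * taylor_mono (ga - 1) (b + 1 + n%:R) (b + (1 - ga)).
Proof.
move=> /andP[ga0 ga1]; have ga1' : 0 <= 1 - ga by rewrite subr_ge0.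
pose F k := f (b + k%:R); pose H := conv (rising_coef (1 - ga)) F.
have HE k : frac_sum b (1 - ga) f (b + (1 - ga) + k%:R) = H k.
  exact: frac_sumE.
have H0 : frac_sum b (1 - ga) f (b + (1 - ga)) = H 0%N.
  by rewrite -HE addr0.
have convH m : conv (rising_coef ga) H m = conv (fun=> 1) F m.
  rewrite /H convA conv_rising_coef [ga + _]addrC subrK.
  by congr conv; apply: funext => k; exact: rising_coef1.
have -> : b + 1 + n%:R = b + (1 - ga) + ga + n%:R by ring.
rewrite H0 frac_sumE//.
have -> : (fun k => fdiff (frac_sum b (1 - ga) f) (b + (1 - ga) + k%:R))
    = fun k => H k.+1 - H k.
  by apply: funext => k; rewrite /fdiff -(HE k.+1) -(HE k) -natr1 (addrA (_ + _)).
rewrite conv_diff !convH (@taylor_mono_rising _ _ _ n.+1)//; last 2 first.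
- by rewrite implybT.
- by rewrite -natr1; ring.
have -> : f (b + (1 - ga) + ga + n%:R) = F n.+1.
  by rewrite /F -natr1; congr f; ring.
by rewrite -(conv_ones_diff F n); ring.
Qed.

End FracSum.

Theorem lemma3p2 (R : realType) (a : R) (f : R -> R) (mu nu : R)
  (hmu0 : 0 < mu) (hmu1 : mu < 1) (hnu0 : 0 <= nu) (hnu1 : nu <= 1)
  (x : R) (hx : nats_from (a + 1) x) :
  [/\ frac_sum (a + 1 - mu) mu (hilfer_diff a mu nu f) x
      = frac_sum (a + (1 - nu) * (1 - mu)) (mu + nu - mu * nu)
          (fdiff (frac_sum a ((1 - nu) * (1 - mu)) f)) x,
      frac_sum (a + 1 - mu) mu (hilfer_diff a mu nu f) x
      = frac_sum (a + (1 - nu) * (1 - mu)) (mu + nu - mu * nu)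
          (frac_diff a (mu + nu - mu * nu) f) x,
      hilfer_diff (a + mu) mu nu (frac_sum a mu f) x
      = frac_sum (a + (1 - nu + mu * nu)) (nu * (1 - mu))
          (frac_diff a (nu * (1 - mu)) f) x
    & hilfer_diff (a + mu) mu nu (frac_sum a mu f) x
      = f x - frac_sum a (1 - nu * (1 - mu)) f (a + 1 - nu * (1 - mu))
              * taylor_mono (nu * (1 - mu) - 1) x (a + 1 - nu * (1 - mu)) ].
Proof.
have [n _ xE] := hx.
have mu0 := ltW hmu0; have mu1 := ltW hmu1.
have ga0 : 0 <= nu * (1 - mu) by rewrite mulr_ge0 ?subr_ge0.
have be0 : 0 <= (1 - nu) * (1 - mu) by rewrite mulr_ge0 ?subr_ge0.
have ga1 : nu * (1 - mu) <= 1 by nra.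
have alE : mu + nu - mu * nu = nu * (1 - mu) + mu by ring.
have parti : frac_sum (a + 1 - mu) mu (hilfer_diff a mu nu f) x
    = frac_sum (a + (1 - nu) * (1 - mu)) (mu + nu - mu * nu)
        (fdiff (frac_sum a ((1 - nu) * (1 - mu)) f)) x.
  have -> : a + 1 - mu = a + (1 - nu) * (1 - mu) + nu * (1 - mu) by ring.
  rewrite alE /hilfer_diff frac_sum_frac_sum//.
  by exists n => //; rewrite -xE; ring.
have ebase : a + mu + (1 - nu) * (1 - mu) = a + (1 - nu * (1 - mu)) by ring.
have partD : hilfer_diff (a + mu) mu nu (frac_sum a mu f) x
    = frac_sum (a + (1 - nu * (1 - mu))) (nu * (1 - mu))
        (fdiff (frac_sum a (1 - nu * (1 - mu)) f)) x.
  rewrite /hilfer_diff ebase; apply: eq_frac_sum => //; last first.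
    by exists n => //; rewrite -xE; ring.
  have inner y : nats_from (a + mu + (1 - nu) * (1 - mu)) y ->
      frac_sum (a + mu) ((1 - nu) * (1 - mu)) (frac_sum a mu f) y
      = frac_sum a (1 - nu * (1 - mu)) f y.
    move=> hy; rewrite frac_sum_frac_sum//; congr (frac_sum _ _ _ _); ring.
  move=> y; rewrite inE -ebase => -[k _ <-]; rewrite /fdiff !inner//.
    by exists k.
  by exists k.+1 => //; rewrite -natr1 addrA.
have partiv : hilfer_diff (a + mu) mu nu (frac_sum a mu f) x
    = f x - frac_sum a (1 - nu * (1 - mu)) f (a + 1 - nu * (1 - mu))
            * taylor_mono (nu * (1 - mu) - 1) x (a + 1 - nu * (1 - mu)).
  have -> : a + 1 - nu * (1 - mu) = a + (1 - nu * (1 - mu)) by ring.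
  by rewrite partD -xE; apply: frac_sum_fdiff_frac_sum; rewrite ga0.
split=> //.
- rewrite parti /frac_diff gt_eqF; last by rewrite alE ltr_wpDl.
  by have -> : 1 - (mu + nu - mu * nu) = (1 - nu) * (1 - mu) by ring.
- (* For nu = 0 the right-hand side is f x by the order-zero convention rather
     than a difference of a sum; the last identity then has a vanishing boundary term. *)
  have [g0|g_neq0] := eqVneq (nu * (1 - mu)) 0; last first.
    rewrite partD /frac_diff (negbTE g_neq0).
    by have -> : 1 - nu + mu * nu = 1 - nu * (1 - mu) by ring.
  by rewrite partiv g0 /frac_diff /frac_sum eqxx sub0r taylor_monoN1 mulr0 subr0.
Qed.
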